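(* Let $G$ be a finite group. Then the unoriented Schur multiplier of $G$ is isomorphic, as a group, to the second cohomology group of $G$ with (trivial) coefficients $\mathbb{Z}_2=\mathbb{Z}/2$: $$\mathcal{M}(G;\mathbb{Z}_2)\cong H^2(G;\mathbb{Z}_2).$$
   Context: Unoriented Schur multiplier. Let $G$ be a group and $S(G)=\langle x^2:x\in G\rangle$ the subgroup generated by squares. Put $[x,y]=xyx^{-1}y^{-1}$, $\{x,y\}=xyx^{-1}y$, $y^x=xyx^{-1}$. Let $(G,G)$ be the free group on the symbols $\langle x,y\rangle$, $(x,y)$ (for $x,y\in G$) and $(z)$ (for $z\in G$). On symbols, $\langle y,z\rangle^x:=\langle y^x,z^x\rangle$, $(y,z)^x:=(y^x,z^x)$, $(z)^x:=(z^x)$. Let $(G,G)\to S(G)$ be the homomorphism with $\langle x,y\rangle\mapsto[x,y]$, $(x,y)\mapsto\{x,y\}$, $(z)\mapsto z^2$, and let $K'$ be its kernel. Let $N'$ be the normal subgroup of $(G,G)$ generated by the following relations ($u\sim v$ meaning $uv^{-1}\in N'$), for all elements of $G$ and all $i,j\in\mathbb{Z}$: (1) $(x^i)(x^j)\sim(x^{i+j})$; (2) $(x,xy)\sim(x)(y)$; (3) $\langle x,y\rangle\sim(x)(x^{-1}y)(y^{-1})$; (4) $\langle xy,z\rangle\sim(y,z)^x(x,z^{-1})$; (5) $\langle y,z\rangle^x\sim\langle x,[y,z]\rangle\langle y,z\rangle$; (6) $(y,z)^x\sim\langle x,\{y,z\}\rangle(y,z)$; (7) $(y^x,z^x)^{-1}\sim(x,\{y,z\}^{-1})(y,z)$;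 (8) $(z)\langle x,y\rangle\sim\langle y,x\rangle^z(z[x,y])$; (9) $(b)\langle a_0,b_0\rangle\sim\langle a_0,b_0\rangle^{b^2}(b)$; (10) $\langle a_0,b_0\rangle(a)\sim(a)\langle a_0,b_0\rangle^{a^{-2}}$. The unoriented Schur multiplier is $\mathcal{M}(G;\mathbb{Z}_2):=K'/N'$. *)

(* Defs.v *)
From HB Require Import structures.
From mathcomp Require Import all_boot all_order all_algebra all_fingroup.
From mathcomp Require Import boolp.

Set Implicit Arguments.
Unset Strict Implicit.
Unset Printing Implicit Defensive.

Import GRing.Theory.

Local Open Scope group_scope.

(* The free group on A consists of the reduced words over the letters (a, e), *)
(* where (a, false) stands for a and (a, true) for a^-1.                      *)

Section FreeGroup.
Variable A : choiceType.

Definition linv (l : A * bool) : A * bool := (l.1, ~~ l.2).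

Definition reduced (w : seq (A * bool)) : bool :=
  sorted [rel k l | l != linv k] w.

Record freeGroup := FreeGroup { fword :> seq (A * bool); _ : reduced fword }.

HB.instance Definition _ := [isSub for fword].
HB.instance Definition _ := [Choice of freeGroup by <:].

Definition fpush (l : A * bool) (w : seq (A * bool)) : seq (A * bool) :=
  if w is k :: w' then if k == linv l then w' else l :: w else [:: l].

Definition fcat (v w : seq (A * bool)) : seq (A * bool) := foldr fpush w v.

Lemma linvK : involutive linv.
Proof. by case=> a e; rewrite /linv /= negbK. Qed.

Lemma fpush_reduced l w : reduced w -> reduced (fpush l w).
Proof.
case: w => [//|k w] /= red_w; case: ifP => [_|/negbT kl]; last by rewrite /= kl.
exact: path_sorted red_w.
Qed.

Lemma fpushK l w : reduced w -> fpush l (fpush (linv l) w) = w.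
Proof.
case: w => [|k w] /=; first by rewrite eqxx.
rewrite linvK; have [->|_] := eqVneq k l; last by rewrite /= eqxx.
by case: w => [//|h w] /= /andP[/negPf -> _].
Qed.

Lemma fcat_reduced v w : reduced w -> reduced (fcat v w).
Proof. by move=> red_w; elim: v => //= l v; apply: fpush_reduced. Qed.

Lemma fcat_push l v w :
  reduced w -> reduced v -> fcat (fpush l v) w = fpush l (fcat v w).
Proof.
case: v => [//|k v] red_w red_v /=; case: ifP => [/eqP -> /=|//].
by rewrite fpushK ?fcat_reduced.
Qed.

Lemma fcatA u v w :
  reduced v -> reduced w -> fcat (fcat u v) w = fcat u (fcat v w).
Proof.
move=> red_v red_w; elim: u => //= l u IHu.
by rewrite fcat_push ?fcat_reduced ?IHu.
Qed.

Lemma fcat0 w : reduced w -> fcat w [::] = w.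
Proof.
elim: w => //= l w IHw red_w; rewrite IHw; last exact: path_sorted red_w.
by case: w red_w {IHw} => [//|k w] /= /andP[/negPf ->].
Qed.

Definition fwinv (w : seq (A * bool)) : seq (A * bool) := rev (map linv w).

Lemma fwinv_reduced w : reduced w -> reduced (fwinv w).
Proof.
rewrite /reduced /fwinv rev_sorted sorted_map; apply: sub_sorted => k l /=.
by rewrite linvK; apply: contra_neq => ->.
Qed.

Lemma fcat_invl w : reduced w -> fcat (fwinv w) w = [::].
Proof.
have frev t v : fcat (rev t) v = foldl (fun v l => fpush l v) v t.
  by rewrite -[in RHS](revK t) foldl_rev.
rewrite /fwinv frev.
elim: w => //= l w IHw red_w; rewrite linvK eqxx.
exact/IHw/(path_sorted red_w).
Qed.

Definition fone : freeGroup := @FreeGroup [::] isT.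
Definition fmul (u v : freeGroup) : freeGroup :=
  FreeGroup (fcat_reduced u (valP v)).
Definition finv (u : freeGroup) : freeGroup :=
  FreeGroup (fwinv_reduced (valP u)).

Fact fmulA : associative fmul.
Proof. by move=> u v w; apply: val_inj; rewrite /= fcatA ?(valP v) ?(valP w). Qed.
Fact fmul1g : left_id fone fmul.
Proof. by move=> u; apply: val_inj. Qed.
Fact fmulg1 : right_id fone fmul.
Proof. by move=> u; apply: val_inj; rewrite /= fcat0 // (valP u). Qed.
Fact fmulVg : left_inverse fone finv fmul.
Proof. by move=> u; apply: val_inj; rewrite /= fcat_invl // (valP u). Qed.
Fact fmulgV : right_inverse fone finv fmul.
Proof.
move=> u; rewrite -[LHS]fmul1g -{1}(fmulVg (finv u)) -fmulA.
by rewrite (fmulA (finv u)) fmulVg fmul1g fmulVg.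
Qed.

HB.instance Definition _ :=
  isGroup.Build freeGroup fmulA fmul1g fmulg1 fmulVg fmulgV.

Definition fgen (a : A) : freeGroup := @FreeGroup [:: (a, false)] isT.

Section Lift.
Variables (H : groupType) (f : A -> H).

Definition letter_val (l : A * bool) : H := if l.2 then (f l.1)^-1 else f l.1.

Definition flift (w : freeGroup) : H := \prod_(l <- fword w) letter_val l.

Lemma letter_valV l : letter_val (linv l) = (letter_val l)^-1.
Proof. by case: l => a []; rewrite /letter_val /= ?invgK. Qed.

Fact flift_monoid_morphism : monoid.monoid_morphism flift.
Proof.
split; first by rewrite /flift big_nil.
case=> u red_u [v red_v]; rewrite /flift /= -big_cat /=.
elim: u {red_u} => //= l u IHu; rewrite big_cons -IHu.
case: (fcat u v) => [|k w] /=; first by rewrite big_cons.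
case: ifP => [/eqP ->|_]; last by rewrite big_cons.
by rewrite big_cons letter_valV mulKVg.
Qed.

HB.instance Definition _ :=
  isUMagmaMorphism.Build freeGroup H flift flift_monoid_morphism.

Lemma flift_gen a : flift (fgen a) = f a.
Proof. by rewrite /flift /= big_seq1. Qed.

End Lift.

End FreeGroup.

(* Normal subgroups are Prop-valued, since membership in the normal subgroup *)
(* generated by a set of relators need not be decidable.                      *)
Record normalSubgroup (H : groupType) := NormalSubgroup {
  nsub_pred :> H -> Prop;
  nsub1 : nsub_pred 1;
  nsubM : forall g h, nsub_pred g -> nsub_pred h -> nsub_pred (g * h);
  nsubV : forall g, nsub_pred g -> nsub_pred g^-1;
  nsubJ : forall g h, nsub_pred g -> nsub_pred (h * g * h^-1)
}.

Section NormalClosure.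
Variables (H : groupType) (P : H -> Prop).

Definition ncl_pred (g : H) : Prop :=
  forall N : normalSubgroup H, (forall h, P h -> N h) -> N g.

Fact ncl1 : ncl_pred 1.
Proof. by move=> N _; apply: nsub1. Qed.
Fact nclM g h : ncl_pred g -> ncl_pred h -> ncl_pred (g * h).
Proof. by move=> Ng Nh N PN; apply: nsubM; [apply: Ng|apply: Nh]. Qed.
Fact nclV g : ncl_pred g -> ncl_pred g^-1.
Proof. by move=> Ng N PN; apply/nsubV/Ng. Qed.
Fact nclJ g h : ncl_pred g -> ncl_pred (h * g * h^-1).
Proof. by move=> Ng N PN; apply/nsubJ/Ng. Qed.

Definition normalClosure : normalSubgroup H := NormalSubgroup ncl1 nclM nclV nclJ.

End NormalClosure.

Section NormalPreimage.
Variables (H K : groupType) (f : UMagmaMorphism.type H K) (N : normalSubgroup K).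

Fact npre1 : N (f 1).
Proof. by rewrite gmulf1; apply: nsub1. Qed.
Fact npreM g h : N (f g) -> N (f h) -> N (f (g * h)).
Proof. by rewrite gmulfM; apply: nsubM. Qed.
Fact npreV g : N (f g) -> N (f g^-1).
Proof. by rewrite gmulfV; apply: nsubV. Qed.
Fact npreJ g h : N (f g) -> N (f (h * g * h^-1)).
Proof. by rewrite !gmulfM gmulfV; apply: nsubJ. Qed.

Definition normalPreimage : normalSubgroup H :=
  @NormalSubgroup H (fun g => N (f g)) npre1 npreM npreV npreJ.

End NormalPreimage.

Section QuotientGroup.
Local Open Scope quotient_scope.
Variables (H : groupType) (N : normalSubgroup H).

Definition ncong (g h : H) : bool := `[< N (g * h^-1) >].

Fact ncong_equiv : equiv_class_of ncong.
Proof.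
split=> [g|g h|h g k].
- by apply/asboolP; rewrite mulgV; apply: nsub1.
- by apply/asboolP/asboolP => /nsubV; rewrite invgM invgK.
- move=> /asboolP Ngh /asboolP Nhk; apply/asboolP.
  by have := nsubM Ngh Nhk; rewrite mulgA mulgVK.
Qed.

Canonical ncong_equivRel := EquivRelPack ncong_equiv.
Canonical ncong_encModRel := defaultEncModRel ncong.

Definition quotientGroup := {eq_quot ncong}.

HB.instance Definition _ := EqQuotient.on quotientGroup.
HB.instance Definition _ := Choice.on quotientGroup.

Lemma quotientGroup_eqP (g h : H) :
  reflect (N (g * h^-1)) (g == h %[mod quotientGroup]).
Proof. by rewrite eqmodE; apply: asboolP. Qed.

Definition qone : quotientGroup := \pi_quotientGroup 1.
Definition qmul (x y : quotientGroup) : quotientGroup :=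
  \pi_quotientGroup (generic_quotient.repr x * generic_quotient.repr y).
Definition qinv (x : quotientGroup) : quotientGroup :=
  \pi_quotientGroup (generic_quotient.repr x)^-1.

Lemma qmulE g h : qmul (\pi g) (\pi h) = \pi_quotientGroup (g * h).
Proof.
rewrite /qmul; case: piP => g' /eqP/quotientGroup_eqP Ng.
case: piP => h' /eqP/quotientGroup_eqP Nh; apply/esym/eqP/quotientGroup_eqP.
have := nsubM (nsubJ g Nh) Ng.
by rewrite invgM !mulgA mulgVK.
Qed.

Lemma qinvE g : qinv (\pi g) = \pi_quotientGroup g^-1.
Proof.
rewrite /qinv; case: piP => g' /eqP/quotientGroup_eqP Ng.
apply/eqP/quotientGroup_eqP; rewrite invgK.
by have := nsubJ g'^-1 Ng; rewrite invgK mulgA mulgVK.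
Qed.

Fact qmulA : associative qmul.
Proof.
move=> x y z; rewrite -[x]generic_quotient.reprK -[y]generic_quotient.reprK.
by rewrite -[z]generic_quotient.reprK !qmulE mulgA.
Qed.
Fact qmul1g : left_id qone qmul.
Proof. by move=> x; rewrite -[x]generic_quotient.reprK qmulE mul1g. Qed.
Fact qmulg1 : right_id qone qmul.
Proof. by move=> x; rewrite -[x]generic_quotient.reprK qmulE mulg1. Qed.
Fact qmulVg : left_inverse qone qinv qmul.
Proof. by move=> x; rewrite -[x]generic_quotient.reprK qinvE qmulE mulVg. Qed.
Fact qmulgV : right_inverse qone qinv qmul.
Proof. by move=> x; rewrite -[x]generic_quotient.reprK qinvE qmulE mulgV. Qed.

HB.instance Definition _ :=
  isGroup.Build quotientGroup qmulA qmul1g qmulg1 qmulVg qmulgV.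

End QuotientGroup.

Section Kernel.
Variables (H K : groupType) (f : UMagmaMorphism.type H K).

Definition kernel_pred : {pred H} := [pred g | f g == 1].

Fact kernel_group_closed : group_closed kernel_pred.
Proof.
split=> [|g h]; first by rewrite inE gmulf1.
by rewrite !inE gmulfF => /eqP -> /eqP ->; rewrite divgg.
Qed.

Record kernelGroup := KernelGroup { kval :> H; _ : kval \in kernel_pred }.

HB.instance Definition _ := [isSub for kval].
HB.instance Definition _ := [Choice of kernelGroup by <:].
HB.instance Definition _ :=
  SubChoice_isSubGroup.Build H kernel_pred kernelGroup kernel_group_closed.

End Kernel.

(* comml x y is [x, y], ucomml x y is {x, y} and conjl x y is y^x; they do   *)
(* not coincide with the library's [~ x, y] = x^-1 * y^-1 * x * y and         *)
(* y ^ x = x^-1 * y * x.                                                      *)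
Definition comml (H : groupType) (x y : H) : H := x * y * x^-1 * y^-1.
Definition ucomml (H : groupType) (x y : H) : H := x * y * x^-1 * y.
Definition conjl (H : groupType) (x y : H) : H := x * y * x^-1.

Definition expgz (H : groupType) (x : H) (i : int) : H :=
  match i with Posz n => x ^+ n | Negz n => x ^- n.+1 end.

Section SchurMultiplier.
Variable gT : finGroupType.

(* squares is S(G), for G the whole group gT. *)
Definition squares : {group gT} := <<[set x ^+ 2 | x : gT]>>%G.

(* SComm x y, SUComm x y and SSq z are the symbols <x, y>, (x, y) and (z). *)
Inductive symbol : Type :=
  | SComm of gT & gT
  | SUComm of gT & gT
  | SSq of gT.

Definition symbol_code (s : symbol) : gT * gT + gT * gT + gT :=
  match s with
  | SComm x y => inl (inl (x, y))
  | SUComm x y => inl (inr (x, y))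
  | SSq z => inr z
  end.

Definition symbol_decode (c : gT * gT + gT * gT + gT) : symbol :=
  match c with
  | inl (inl p) => SComm p.1 p.2
  | inl (inr p) => SUComm p.1 p.2
  | inr z => SSq z
  end.

Lemma symbol_codeK : cancel symbol_code symbol_decode.
Proof. by case. Qed.

HB.instance Definition _ := Choice.copy symbol (can_type symbol_codeK).

Definition symbolConj (x : gT) (s : symbol) : symbol :=
  match s with
  | SComm y z => SComm (conjl x y) (conjl x z)
  | SUComm y z => SUComm (conjl x y) (conjl x z)
  | SSq z => SSq (conjl x z)
  end.

Lemma sq_squares z : z ^+ 2 \in squares.
Proof. by apply/mem_gen/imsetP; exists z. Qed.

Lemma ucomml_squares x y : ucomml x y \in squares.
Proof.
have -> : ucomml x y = x ^+ 2 * (x^-1 * y) ^+ 2.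
  by rewrite /ucomml !expgS !expg0 !mulg1 !mulgA mulgK.
by rewrite groupM ?sq_squares.
Qed.

Lemma comml_squares x y : comml x y \in squares.
Proof.
have -> : comml x y = ucomml x y * y^-1 ^+ 2.
  by rewrite /ucomml /comml !expgS !expg0 !mulg1 !mulgA mulgK.
by rewrite groupM ?sq_squares ?ucomml_squares.
Qed.

Definition symbol_val (s : symbol) : [subg squares] :=
  match s with
  | SComm x y => Subg (comml_squares x y)
  | SUComm x y => Subg (ucomml_squares x y)
  | SSq z => Subg (sq_squares z)
  end.

Local Notation F := (freeGroup symbol).
Local Notation "⟨ x , y ⟩" := (fgen (SComm x y)) (x at level 200, y at level 200).
Local Notation "⦅ x , y ⦆" := (fgen (SUComm x y)) (x at level 200, y at level 200).
Local Notation "⦅ z ⦆" := (fgen (SSq z)) (z at level 200).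
Local Notation "⟨ y , z ⟩ '^^' x" := (fgen (symbolConj x (SComm y z)))
  (y at level 200, z at level 200, x at level 9).
Local Notation "⦅ y , z ⦆ '^^' x" := (fgen (symbolConj x (SUComm y z)))
  (y at level 200, z at level 200, x at level 9).

(* schur_relation u v lists the defining relations u ~ v of N'. *)
Inductive schur_relation : F -> F -> Prop :=
  | Rel1 x (i j : int) :
      schur_relation (⦅expgz x i⦆ * ⦅expgz x j⦆) ⦅expgz x (i + j)%R⦆
  | Rel2 x y : schur_relation ⦅x, x * y⦆ (⦅x⦆ * ⦅y⦆)
  | Rel3 x y : schur_relation ⟨x, y⟩ (⦅x⦆ * ⦅x^-1 * y⦆ * ⦅y^-1⦆)
  | Rel4 x y z : schur_relation ⟨x * y, z⟩ (⦅y, z⦆^^x * ⦅x, z^-1⦆)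
  | Rel5 x y z : schur_relation (⟨y, z⟩^^x) (⟨x, comml y z⟩ * ⟨y, z⟩)
  | Rel6 x y z : schur_relation (⦅y, z⦆^^x) (⟨x, ucomml y z⟩ * ⦅y, z⦆)
  | Rel7 x y z :
      schur_relation ⦅conjl x y, conjl x z⦆^-1 (⦅x, (ucomml y z)^-1⦆ * ⦅y, z⦆)
  | Rel8 x y z :
      schur_relation (⦅z⦆ * ⟨x, y⟩) (⟨y, x⟩^^z * ⦅z * comml x y⦆)
  | Rel9 a0 b0 b :
      schur_relation (⦅b⦆ * ⟨a0, b0⟩) (⟨a0, b0⟩^^(b ^+ 2) * ⦅b⦆)
  | Rel10 a0 b0 a :
      schur_relation (⟨a0, b0⟩ * ⦅a⦆) (⦅a⦆ * ⟨a0, b0⟩^^(a ^- 2)).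

Definition schur_relator (w : F) : Prop :=
  exists u v : F, schur_relation u v /\ w = u * v^-1.

(* This is N'. *)
Definition schur_relators : normalSubgroup F := normalClosure schur_relator.

(* This is K'. *)
Definition schur_kernel : groupType := kernelGroup (flift symbol_val).

(* This is K'/N'; schur_relators_sub below shows that N' is included in K'. *)
Definition unorientedSchurMultiplier : groupType :=
  quotientGroup
    (normalPreimage (val : UMagmaMorphism.type schur_kernel F) schur_relators).

Lemma expgzD (x : gT) (i j : int) : expgz x (i + j)%R = expgz x i * expgz x j.
Proof.
have expgzB (m n : nat) : expgz x (m%:Z - n%:Z)%R = x ^+ m * x ^- n.
  have [le_nm | /ltnW le_mn] := leqP n m.
    by rewrite subzn // -[in RHS](subnK le_nm) expgnDr mulgK.
  rewrite -opprB subzn // -[in RHS](subnK le_mn) expgnDr invgM mulKVg.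
  by case: (n - m)%N => [|k]; rewrite ?invg1.
have expgzE k : exists m n : nat, (k = m%:Z - n%:Z)%R.
  case: k => n; first by exists n, 0%N; rewrite subr0.
  by exists 0%N, n.+1; rewrite sub0r.
have [m [n ->]] := expgzE i; have [p [q ->]] := expgzE j.
rewrite addrACA -opprD -!PoszD !expgzB !expgnDr invgM.
rewrite -!mulgA; congr (_ * _).
have comm_x : commute (x ^+ p * x ^- q) (x ^- n).
  by apply/commuteV/commute_sym/commuteM; [|apply: commuteV]; apply: commuteX2.
by rewrite -comm_x mulgA.
Qed.

Lemma schur_relation_val (u v : F) :
  schur_relation u v -> flift symbol_val u = flift symbol_val v.
Proof.
case=> *; rewrite ?(gmulfM, gmulfV) /= ?flift_gen; apply: val_inj => /=.
all: rewrite ?expgzD /comml /ucomml /conjl ?expgS ?expg0 ?mulg1 ?(invgK, invgM).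
all: rewrite ?mulgA ?(mulgK, mulgVK) ?(mulgV, mul1g) //.
by congr (_ * _); rewrite -!mulgA; congr (_ * _); rewrite -!expgzD addrC.
Qed.

Lemma schur_relators_sub (w : F) : schur_relators w -> flift symbol_val w = 1.
Proof.
have K1 : flift symbol_val 1 = 1 by rewrite gmulf1.
have KM (g h : F) : flift symbol_val g = 1 -> flift symbol_val h = 1 ->
    flift symbol_val (g * h) = 1 by rewrite gmulfM /= => -> ->; rewrite mulg1.
have KV (g : F) : flift symbol_val g = 1 -> flift symbol_val g^-1 = 1.
  by rewrite gmulfV /= => ->; rewrite invg1.
have KJ (g h : F) : flift symbol_val g = 1 ->
    flift symbol_val (h * g * h^-1) = 1.
  by rewrite !gmulfM gmulfV /= => ->; rewrite mulg1 mulgV.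
move/(_ (NormalSubgroup K1 KM KV KJ)); apply=> _ [u [v [uv ->]]].
by rewrite /= gmulfM gmulfV /= (schur_relation_val uv) mulgV.
Qed.

End SchurMultiplier.

(* Inhomogeneous cochains of gT with values in the trivial module A. *)
Section Cohomology.
Local Open Scope ring_scope.
Variables (gT : finGroupType) (A : zmodType).

Definition cobound1 (f : {ffun gT -> A}) : {ffun gT * gT -> A} :=
  [ffun p => f p.2 - f (p.1 * p.2)%g + f p.1].

Definition cobound2 (c : {ffun gT * gT -> A}) : {ffun gT * gT * gT -> A} :=
  [ffun t => let: (x, y, z) := t in
     c (y, z) - c ((x * y)%g, z) + c (x, (y * z)%g) - c (x, y)].

Lemma cobound2_cobound1 (f : {ffun gT -> A}) : cobound2 (cobound1 f) = 0.
Proof.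
apply/ffunP=> -[[x y] z]; rewrite !ffunE /= mulgA !opprD !opprK !addrA.
rewrite (ACl (1*4*(2*7)*(3*10)*(5*8)*(6*11)*(9*12))) /=.
by rewrite !subrr !addNr !addr0.
Qed.

Definition cocycle2_pred : {pred {ffun gT * gT -> A}} :=
  [pred c | cobound2 c == 0].

Fact cocycle2_zmod_closed : zmod_closed cocycle2_pred.
Proof.
have d2B : {morph cobound2 : b c / b - c}.
  move=> b c; apply/ffunP=> -[[x y] z]; rewrite !ffunE.
  rewrite !opprD !opprK [RHS]addrACA; congr (_ + _).
  by rewrite [RHS]addrACA; congr (_ + _); rewrite [RHS]addrACA.
split=> [|b c]; rewrite !inE; first by rewrite -(subrr 0) d2B subrr.
by rewrite d2B => /eqP -> /eqP ->; rewrite subrr.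
Qed.

Record cocycle2 := Cocycle2 {
  cocycle2_val :> {ffun gT * gT -> A};
  _ : cocycle2_val \in cocycle2_pred
}.

HB.instance Definition _ := [isSub for cocycle2_val].
HB.instance Definition _ := [Choice of cocycle2 by <:].
HB.instance Definition _ :=
  GRing.SubChoice_isSubZmodule.Build _ cocycle2_pred cocycle2 cocycle2_zmod_closed.

Definition coboundary2 : {pred cocycle2} :=
  [pred c : cocycle2 | `[< exists f, cobound1 f = val c >]].

Fact coboundary2_zmod_closed : zmod_closed coboundary2.
Proof.
have d1B : {morph cobound1 : f g / f - g}.
  move=> f g; apply/ffunP=> p; rewrite !ffunE !opprD !opprK.
  by rewrite [RHS]addrACA; congr (_ + _); rewrite [RHS]addrACA.
split=> [|b c]; rewrite !inE.
  by apply/asboolP; exists (0 - 0); rewrite d1B subrr.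
move=> /asboolP[f df] /asboolP[g dg]; apply/asboolP; exists (f - g).
by rewrite d1B df dg.
Qed.

HB.instance Definition _ :=
  GRing.isZmodClosed.Build cocycle2 coboundary2 coboundary2_zmod_closed.

Definition cohomology2 : zmodType := Quotient.quot coboundary2.

End Cohomology.

(* Main.v *)
Require Import Defs.
From HB Require Import structures.
From mathcomp Require Import all_boot all_order all_algebra all_fingroup.
From mathcomp Require Import boolp classical_sets ring.

(* Let U = (G,G)/N' and let d : U -> S(G) be the boundary map. The relations  *)
(* give u^2 = (d u) and [u, v] = <d u, d v> in U, so the kernel M = K'/N' of  *)
(* d is central of exponent 2. Adjoining one square root at a time, U embeds  *)
(* in an extension p : E -> G of the whole of G by M in which e^2 = (p e) for *)
(* every e.                                                                   *)
(*   A cocycle c : G x G -> Z/2 twists G x Z/2 into a group; the symbols can  *)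
(* be evaluated there on arbitrary lifts, and restricting the evaluation to   *)
(* K' gives a pairing M x H^2(G; Z/2) -> Z/2. It is nondegenerate on the left *)
(* because a functional on M nonzero at a given point pushes E forward to     *)
(* such a twisted product. It is nondegenerate on the right because a twisted *)
(* product where Z/2 misses the subgroup generated by the squares has a       *)
(* homomorphism to Z/2 that is nontrivial on Z/2, so it splits. As H^2 is a   *)
(* finite-dimensional F_2-space, M is isomorphic to its dual, hence to H^2.   *)

Set Implicit Arguments.
Unset Strict Implicit.
Unset Printing Implicit Defensive.

Import GRing.Theory.

Local Open Scope group_scope.

(** The isomorphism comes from a pairing of K'/N' with H^2 that is nondegenerate on both sides. Each
    symbol stands for a product of squares, and in an extension of G by a central group of exponent
    2 a square depends only on its image in G ([tw_sqr_congr]). So symbols can be evaluated in every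
    twisted product, and the evaluation kills N' ([tw_relation]). Conversely, [sym_comm] and
    [sym_sqr] show that the group U of symbols modulo N' behaves like the subgroup of squares of
    such an extension, and [squareExt_exists] constructs that extension. With it,
    [pairing_nondegenerate] detects every element of K' outside N'; [pairing_eq0_cobound] detects
    every nonzero class. Both take their homomorphisms to Z/2 from [square_separation]. An F_2-basis
    of H^2 ([F2_coordinates]) then identifies K'/N' with the dual of H^2, and the dual with H^2,
    non-canonically. *)

Lemma ucomml_sqr (H : groupType) (x y : H) :
  ucomml x y = x ^+ 2 * (x^-1 * y) ^+ 2.
Proof. by rewrite /ucomml !expgS !expg0 !mulg1 !mulgA mulgK. Qed.

Lemma comml_sqr (H : groupType) (x y : H) :
  comml x y = x ^+ 2 * (x^-1 * y) ^+ 2 * (y^-1) ^+ 2.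
Proof.
by rewrite -ucomml_sqr /ucomml /comml !expgS !expg0 !mulg1 !mulgA mulgK.
Qed.

(** * Free groups and quotients by normal subgroups *)

Section FreeGroupInduction.
Variable A : choiceType.

Lemma freeGroup_ind (P : freeGroup A -> Prop) :
    P 1 -> (forall a w, P w -> P (fgen a * w)) ->
    (forall a w, P w -> P ((fgen a)^-1 * w)) ->
  forall w, P w.
Proof.
move=> P1 Pgen Pinv [s]; elim: s => [|l s IHs] red_s.
  by rewrite (_ : FreeGroup _ = 1) //; apply: val_inj.
have red_s' : reduced s by apply: path_sorted red_s.
have fpushE : fpush l s = l :: s.
  by case: s red_s {IHs red_s'} => //= k s /andP[/negPf-> _].
case: l red_s fpushE => a [] red_s fpushE.
  rewrite (_ : FreeGroup _ = (fgen a)^-1 * FreeGroup red_s').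
    exact/Pinv/IHs.
  exact/val_inj/esym.
rewrite (_ : FreeGroup _ = fgen a * FreeGroup red_s').
  exact/Pgen/IHs.
exact/val_inj/esym.
Qed.

End FreeGroupInduction.

Section NormalQuotient.
Local Open Scope quotient_scope.
Variables (H : groupType) (N : normalSubgroup H).

Definition qclass (g : H) : quotientGroup N := \pi g.

Lemma qclassM g h : qclass (g * h) = qclass g * qclass h.
Proof. by rewrite [RHS]qmulE. Qed.

Lemma qclass1 : qclass 1 = 1. Proof. by []. Qed.

Lemma qclassV g : qclass g^-1 = (qclass g)^-1.
Proof. by rewrite [RHS]qinvE. Qed.

Lemma qclassP g h : qclass g = qclass h <-> N (g * h^-1).
Proof.
by split=> [/eqP/quotientGroup_eqP|Ngh]; last apply/eqP/quotientGroup_eqP.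
Qed.

Lemma qclassK (x : quotientGroup N) : qclass (generic_quotient.repr x) = x.
Proof. exact: reprK. Qed.

(** The first isomorphism theorem, for a surjection [f] with kernel [N] onto an additive group. *)
Lemma quotientGroup_bij (V : zmodType) (f : H -> V) :
    (forall g h, f (g * h) = (f g + f h)%R) -> (forall g, f g = 0%R <-> N g) ->
    (forall v, exists g, f g = v) ->
  exists F : quotientGroup N -> V,
    {morph F : u v / u * v >-> (u + v)%R} /\ bijective F.
Proof.
move=> fM fN f_surj.
have f1 : f 1 = 0%R by apply/fN; exact: nsub1.
have fV g : f g^-1 = (- f g)%R.
  by apply/eqP; rewrite -subr_eq0 opprK -fM mulVg f1.
have f_eq g h : f g = f h <-> qclass g = qclass h.
  rewrite qclassP -fN fM fV; split=> [->|/eqP]; first by rewrite subrr.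
  by rewrite subr_eq0 => /eqP.
have [s sK] := choice f_surj.
exists (fun x => f (generic_quotient.repr x)); split.
  by move=> u v; rewrite -fM; apply/f_eq; rewrite qclassM !qclassK.
exists (fun v => qclass (s v)) => [x|v].
  by rewrite -[RHS]qclassK; apply/f_eq; rewrite sK.
by rewrite -[RHS]sK; apply/f_eq; rewrite qclassK.
Qed.

End NormalQuotient.

(** * The quotient of the symbol group by the relations *)

Section SymbolGroup.
Variable gT : finGroupType.

Definition symbolGroup : groupType := quotientGroup (schur_relators gT).
Local Notation U := symbolGroup.

Definition symclass (s : symbol gT) : U := qclass (schur_relators gT) (fgen s).
Definition symq (z : gT) : U := symclass (SSq z).
Definition symc (x y : gT) : U := symclass (SComm x y).
Definition symd (x y : gT) : U := symclass (SUComm x y).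
Local Notation q := symq.
Local Notation c := symc.
Local Notation d := symd.

Lemma qclass_relation u v :
  schur_relation u v -> qclass (schur_relators gT) u = qclass _ v.
Proof. by move=> uv; apply/qclassP => N; apply; exists u, v. Qed.

Lemma symqX x i j : q (expgz x i) * q (expgz x j) = q (expgz x (i + j)%R).
Proof. by rewrite -qclassM; apply/qclass_relation/Rel1. Qed.

Lemma symq1 : q 1 = 1.
Proof.
have := symqX 1 (Posz 0) (Posz 0).
by rewrite /= expg0 => /(canRL (mulgK _)); rewrite mulgV.
Qed.

Lemma symqV x : q x^-1 = (q x)^-1.
Proof.
have /= := symqX x (Posz 1) (Negz 0).
by rewrite expg0 symq1 expg1 => /(canRL (mulKg _)); rewrite mulg1.
Qed.

Lemma symqXX x : q (x ^+ 2) = q x ^+ 2.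
Proof. by have /= := symqX x (Posz 1) (Posz 1); rewrite expg1 expgS expg1. Qed.

Lemma symdE x y : d x y = q x * q (x^-1 * y).
Proof.
by rewrite -qclassM -{1}[y](mulKVg x); apply/qclass_relation/Rel2.
Qed.

Lemma symd1 y : d 1 y = q y.
Proof. by rewrite symdE symq1 mul1g invg1 mul1g. Qed.

Lemma symcE x y : c x y = q x * q (x^-1 * y) * q y^-1.
Proof. by rewrite /symc /symclass (qclass_relation (Rel3 x y)) !qclassM. Qed.

Lemma symdc x y : d x y = c x y * q y.
Proof. by rewrite symcE symqV mulgVK symdE. Qed.

Lemma symcV x y : (c x y)^-1 = c y x.
Proof. by rewrite !symcE !invgM -!symqV !invgM !invgK mulgA. Qed.

Lemma symcc x : c x x = 1.
Proof. by rewrite symcE mulVg symq1 mulg1 symqV mulgV. Qed.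

Lemma symc1 x : c 1 x = 1.
Proof. by rewrite symcE symq1 invg1 !mul1g symqV mulgV. Qed.

(** Relation (4) at [y = 1] computes its own factor [d x z^-1]; substituting this back leaves only
    commutator symbols. *)
Lemma symcMl x y z : c (x * y) z = c (conjl x y) (conjl x z) * c x z.
Proof.
have R4 y' : c (x * y') z = d (conjl x y') (conjl x z) * d x z^-1.
  by rewrite -qclassM; apply/qclass_relation/Rel4.
have := R4 1; rewrite mulg1 {1}/conjl mulg1 mulgV symd1 => ->.
by rewrite R4 symdc !mulgA.
Qed.

Lemma symcMr x y z : c x (y * z) = c x y * c (conjl y x) (conjl y z).
Proof. by rewrite -symcV symcMl invgM !symcV. Qed.

Lemma symcJ x y z : c (conjl x y) (conjl x z) = c x (comml y z) * c y z.
Proof. by rewrite -qclassM; apply/qclass_relation/Rel5. Qed.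

(** Relation (6) with first entry 1, since (1, y) = (y) and {1, y} = y^2. *)
Lemma symqJ x y : q (conjl x y) = c x (y ^+ 2) * q y.
Proof.
have -> : q (conjl x y) = d (conjl x 1) (conjl x y).
  by rewrite {2}/conjl mulg1 mulgV symd1.
rewrite -[q y]symd1 -qclassM (_ : y ^+ 2 = ucomml 1 y).
  by apply/qclass_relation/Rel6.
by rewrite /ucomml invg1 mulg1 mul1g.
Qed.

(** Relation (7) with trivial conjugator, solved for the square. *)
Lemma symd_sqr x y : d x y ^+ 2 = q (ucomml x y).
Proof.
have : (d (conjl 1 x) (conjl 1 y))^-1 = d 1 (ucomml x y)^-1 * d x y.
  by rewrite -qclassM -qclassV; apply/qclass_relation/Rel7.
rewrite /conjl !mul1g invg1 !mulg1 symd1 symqV => /(canLR (mulKVg _)).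
by move=> /(canRL (mulgVK _)) ->; rewrite expgS expg1.
Qed.

Definition symbdry (u : U) : gT :=
  sgval (flift (@symbol_val gT) (generic_quotient.repr u)).
Local Notation bd := symbdry.

Lemma symbdry_class w :
  bd (qclass (schur_relators gT) w) = sgval (flift (@symbol_val gT) w).
Proof.
have /qclassP/schur_relators_sub := qclassK (qclass (schur_relators gT) w).
rewrite gmulfM gmulfV => /(canRL (mulgVK _)) /=; rewrite mul1g.
by rewrite /symbdry => ->.
Qed.

Lemma symbdryM u v : bd (u * v) = bd u * bd v.
Proof.
by rewrite -[u]qclassK -[v]qclassK -qclassM !symbdry_class gmulfM.
Qed.

Lemma symbdryV u : bd u^-1 = (bd u)^-1.
Proof. by rewrite -[u]qclassK -qclassV !symbdry_class gmulfV. Qed.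

Lemma symbdry1 : bd 1 = 1.
Proof. by rewrite -qclass1 symbdry_class gmulf1. Qed.

Lemma symbdry_q z : bd (q z) = z ^+ 2.
Proof. by rewrite symbdry_class flift_gen. Qed.

Lemma symbdry_c x y : bd (c x y) = comml x y.
Proof. by rewrite symbdry_class flift_gen. Qed.

(** Relations (2) and (3) write the other symbols in terms of the (z), and (z)^-1 = (z^-1), so the
    (z) generate U even as a monoid. *)
Lemma symbolGroup_ind (P : U -> Prop) :
  P 1 -> (forall z u, P u -> P (q z * u)) -> forall u, P u.
Proof.
move=> P1 Pq u.
have Psym s v : P v -> P (symclass s * v) /\ P ((symclass s)^-1 * v).
  move=> Pv; case: s => [x y|x y|z].
  - rewrite -/(c x y) symcV !symcE -!mulgA.
    by split; do 3!apply: (Pq _ _).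
  - rewrite -/(d x y) symdE invgM -!symqV -!mulgA.
    by split; do 2!apply: (Pq _ _).
  - by rewrite -/(q z) -symqV; split; apply: Pq.
suff Pw w v : P v -> P (qclass _ w * v).
  by rewrite -[u]mulg1 -[u]qclassK; apply: Pw.
elim/freeGroup_ind: w v => [v|a w IHw v|a w IHw v] Pv.
- by rewrite mul1g.
- by rewrite qclassM -mulgA; case: (Psym a (qclass _ w * v)) => //; apply: IHw.
- rewrite qclassM qclassV -mulgA.
  by case: (Psym a (qclass _ w * v)) => //; apply: IHw.
Qed.

(** For a generator [u = q z] this is relation (9), as [bd (q z) = z ^+ 2]. *)
Lemma symcJu u x y : u * c x y * u^-1 = c (conjl (bd u) x) (conjl (bd u) y).
Proof.
elim/symbolGroup_ind: u => [|z u IHu].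
  by rewrite symbdry1 /conjl !mul1g !invg1 !mulg1.
rewrite invgM (_ : _ * _ = q z * (u * c x y * u^-1) * (q z)^-1); last first.
  by rewrite !mulgA.
rewrite {}IHu symbdryM symbdry_q.
have JM a b t : conjl (a * b) t = conjl a (conjl b t) :> gT.
  by rewrite /conjl invgM !mulgA.
rewrite !(JM (z ^+ 2)); set a := conjl _ x; set b := conjl _ y.
have := qclass_relation (Rel9 a b z); rewrite !qclassM => R9.
by rewrite [q z * _]R9 mulgK.
Qed.

(** By (3), the right side is a product of symbols of squares. Since
    [q (a ^+ 2 * b ^+ 2) = (q a * q b) ^+ 2], it becomes the expression of a commutator by three
    squares. *)
Lemma symq_comm x y : comml (q x) (q y) = c (x ^+ 2) (y ^+ 2).
Proof.
have qM a b : q (a ^+ 2 * b ^+ 2) = (q a * q b) ^+ 2.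
  have <- : d a (a * b) = q a * q b by rewrite symdE mulKg.
  by rewrite symd_sqr /ucomml !expgS !expg0 !mulg1 !mulgA mulgVK.
rewrite symcE -!expVgn qM !symqXX !symqV /comml !expgS !expg0 !mulg1 !mulgA.
by rewrite !mulgK.
Qed.

(** Both sides obey the same crossed product rule in each argument, so the case of generators
    suffices. In particular the kernel of [bd] is central. *)
Lemma sym_comm u v : comml u v = c (bd u) (bd v).
Proof.
have commM (a b t : U) : comml (a * b) t = a * comml b t * a^-1 * comml a t.
  by rewrite /comml invgM !mulgA !mulgVK.
have commV (a b : U) : (comml a b)^-1 = comml b a.
  by rewrite /comml !invgM !invgK !mulgA.
have comm_q z : comml u (q z) = c (bd u) (z ^+ 2).
  elim/symbolGroup_ind: u => [|x u IHu].
    by rewrite symbdry1 symc1 /comml mul1g invg1 mulg1 mulgV.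
  by rewrite commM IHu symcJu symq_comm symbdryM symbdry_q symcMl.
elim/symbolGroup_ind: v => [|z v IHv].
  by rewrite symbdry1 -symcV symc1 /comml !invg1 !mulg1 mulgV.
rewrite -commV commM -[comml v u]commV IHv -[comml (q z) u]commV comm_q !symcV.
by rewrite symcJu symbdryM symbdry_q -symcMl symcV.
Qed.

(** Expand both sides of [d (a * b) b = d a b] at [a = conjl x y], [b = x]. *)
Lemma symqM x y : q (x * y) = c (conjl x y) x * q x * q y.
Proof.
have dMl a b : d (a * b) b = d a b.
  rewrite !symdc symcMl.
  by rewrite symcc mul1g.
have := dMl (conjl x y) x; rewrite {1}/conjl mulgVK symdE symdc.
rewrite (_ : (x * y)^-1 * x = y^-1); last by rewrite invgM mulgVK.
by rewrite symqV => /(canRL (mulgVK _)).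
Qed.

(** By [symqM] and [sym_comm], both sides pick up the same commutator when [u] is multiplied by a
    generator. Hence the kernel of [bd] has exponent 2. *)
Lemma sym_sqr u : u ^+ 2 = q (bd u).
Proof.
elim/symbolGroup_ind: u => [|z u IHu].
  by rewrite symbdry1 symq1 expg1n.
rewrite symbdryM symqM -IHu symbdry_q symqXX.
have -> : c (conjl (z ^+ 2) (bd u)) (z ^+ 2) = q z * comml u (q z) * (q z)^-1.
  rewrite sym_comm symcJu symbdry_q; congr (c _ _).
  by rewrite /conjl mulgK.
by rewrite /comml !expgS !expg0 !mulg1 !mulgA !mulgVK.
Qed.

End SymbolGroup.

(** * Extensions of G with prescribed squares *)

(* D is the group generated by E and a square root of t acting on E by s; the *)
(* pair (e, b) stands for e times the b-th power of that root.                *)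
Section DoubleExtension.
Variables (E : groupType) (s : E -> E) (t : E).
Hypotheses (sM : {morph s : e f / e * f}) (st : s t = t).
Hypothesis ss : forall e, s (s e) = t * e * t^-1.

(** The hypotheses are phantom arguments, so that the type determines [s] and [t] and can carry the
    group structure. *)
Definition doubleExt of {morph s : e f / e * f} & s t = t
  & (forall e, s (s e) = t * e * t^-1) : Type := (E * bool)%type.
Local Notation D := (doubleExt sM st ss).

HB.instance Definition _ := Choice.on D.

Definition dmul (x y : D) : D :=
  match x, y with
  | (e, false), (f, b) => (e * f, b)
  | (e, true), (f, false) => (e * s f, true)
  | (e, true), (f, true) => (e * s f * t, false)
  end.

Definition dinv (x : D) : D :=
  match x with
  | (e, false) => (e^-1, false)
  | (e, true) => (t^-1 * (s e)^-1, true)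
  end.

Let s1 : s 1 = 1.
Proof. by apply: (mulgI (s 1)); rewrite -sM !mulg1. Qed.

Let sV e : s e^-1 = (s e)^-1.
Proof. by apply: (mulgI (s e)); rewrite -sM !mulgV. Qed.

Fact dmulA : associative dmul.
Proof.
move=> [e []] [f []] [g []] //=; rewrite ?mulgA // ?sM ?ss ?st ?mulgA //.
all: by rewrite ?mulgVK.
Qed.

Fact dmul1g : left_id ((1, false) : D) dmul.
Proof. by case=> e b; rewrite /= mul1g. Qed.

Fact dmulg1 : right_id ((1, false) : D) dmul.
Proof. by case=> e []; rewrite /= ?s1 mulg1. Qed.

Fact dmulVg : left_inverse ((1, false) : D) dinv dmul.
Proof. by case=> e [] /=; rewrite ?mulgVK ?mulVg. Qed.

Fact dmulgV : right_inverse ((1, false) : D) dinv dmul.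
Proof.
case=> e [] /=; last by rewrite mulgV.
by rewrite sM !sV ss st !invgM invgK !mulgA !mulgVK mulgV.
Qed.

HB.instance Definition _ := isGroup.Build D dmulA dmul1g dmulg1 dmulVg dmulgV.

End DoubleExtension.

Section SquareExtension.
Variable gT : finGroupType.
Local Notation U := (symbolGroup gT).
Local Notation q := (@symq gT).
Local Notation c := (@symc gT).
Local Notation bd := (@symbdry gT).

(* E is an extension of the subgroup p(E) of gT by the kernel M = K'/N' of    *)
(* bd, with U embedded in E by i as the subgroup generated by the squares.    *)
Record squareExt (E : groupType) (p : E -> gT) (i : U -> E) : Prop :=
    SquareExt {
  extM : {morph p : e f / e * f};
  extiM : {morph i : u v / u * v};
  exti_inj : injective i;
  extpi : forall u, p (i u) = bd u;
  ext_sqr : forall e, e ^+ 2 = i (q (p e));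
  ext_ker : forall e, p e = 1 -> exists u, e = i u
}.

Lemma squareExt_base : squareExt bd (@id U).
Proof.
by split=> //; [apply: symbdryM | apply: sym_sqr | move=> e; exists e].
Qed.

Section Theory.
Variables (E : groupType) (p : E -> gT) (i : U -> E).
Hypothesis ext : squareExt p i.
Let pM := extM ext.
Let iM := extiM ext.
Let pi_ := extpi ext.

Lemma ext1 : p 1 = 1.
Proof. by apply: (mulgI (p 1)); rewrite -pM !mulg1. Qed.

Lemma exti1 : i 1 = 1.
Proof. by apply: (mulgI (i 1)); rewrite -iM !mulg1. Qed.

Lemma extV e : p e^-1 = (p e)^-1.
Proof. by apply: (mulgI (p e)); rewrite -pM !mulgV ext1. Qed.

Lemma extiV u : i u^-1 = (i u)^-1.
Proof. by apply: (mulgI (i u)); rewrite -iM !mulgV exti1. Qed.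

Lemma ext_comm e f : comml e f = i (c (p e) (p f)).
Proof.
rewrite symcE !iM -(extV f) -(extV e) -pM -!(ext_sqr ext).
by rewrite /comml !expgS !expg0 !mulg1 !mulgA mulgK mulgK.
Qed.

Lemma extJ e u : conjl e (i u) = i (c (p e) (bd u) * u).
Proof. by rewrite iM -pi_ -ext_comm /comml mulgVK. Qed.

Lemma extJc e x y :
  conjl e (i (c x y)) = i (c (conjl (p e) x) (conjl (p e) y)).
Proof. by rewrite extJ symbdry_c symcJ. Qed.

Lemma ext_central e u : bd u = 1 -> e * i u = i u * e.
Proof.
move=> u1; have := extJ e u; rewrite u1 -symcV symc1 invg1 mul1g.
by move/(canRL (mulgVK _)).
Qed.

Variable x : gT.
Hypothesis xE : forall e, p e <> x.

(** The action forced on E by conjugation with a new element r over [x]: r e r^-1 = [r, e] e, where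
    [ext_comm] requires [r, e] to be [i (c x (p e))]. Likewise r^2 must be [i (q x)]. *)
Definition ext_twist (e : E) : E := i (c x (p e)) * e.
Local Notation s := ext_twist.
Local Notation t := (i (q x)).

Fact ext_twistM : {morph s : e f / e * f}.
Proof.
move=> e f; rewrite /s pM symcMr iM -extJc /conjl !mulgA.
by rewrite mulgVK.
Qed.

Fact ext_twistt : s t = t.
Proof.
by rewrite /s pi_ symbdry_q -iM -symqJ /conjl mulgK.
Qed.

Fact ext_twist2 e : s (s e) = t * e * t^-1.
Proof.
rewrite /s pM pi_ symbdry_c /comml mulgVK mulgA -iM.
have -> : c x (x * p e * x^-1) = c (conjl x x) (conjl x (p e)).
  by rewrite /conjl mulgK.
have -> : t * e * t^-1 = comml t e * e by rewrite /comml mulgVK.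
by rewrite -symcMl ext_comm pi_ symbdry_q.
Qed.

Local Notation D := (doubleExt ext_twistM ext_twistt ext_twist2).

(** The image p(E) contains all squares, so p(E) and its coset p(E)x together form a subgroup, which
    is the image of the new extension. *)
Lemma squareExt_step :
  exists (E' : groupType) (p' : E' -> gT) (i' : U -> E'),
    [/\ squareExt p' i', exists e, p' e = x
      & forall e, exists e', p' e' = p e].
Proof.
pose p' (d : D) : gT := if d.2 then p d.1 * x else p d.1.
exists D, p', (fun u => (i u, false) : D); split; last first.
- by move=> e; exists (e, false).
- by exists (1, true); rewrite /p' /= ext1 mul1g.
have psE e : p (i (c x (p e))) * p e * x = x * p e.
  by rewrite pi_ symbdry_c /comml !mulgVK.
split.
- case=> e [] [f []]; rewrite /p' /= ?pM ?mulgA //.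
    by rewrite -(mulgA (p e) x) -psE !pi_ symbdry_q !mulgA.
  by rewrite -(mulgA (p e) x) -psE !mulgA.
- by move=> u v; rewrite iM.
- by move=> u v [/(exti_inj ext)].
- by move=> u; rewrite /p' /= pi_.
- case=> e []; rewrite expgS expg1 /p' /=; last first.
    by rewrite -(ext_sqr ext) expgS expg1.
  (* With r the new root, (e r)^2 = (e [r, e] e^-1) e^2 r^2, which matches [symqM] factor by
     factor. *)
  congr (_, _); rewrite symqM iM iM -(ext_sqr ext e).
  have {2}<- : conjl (p e) (p e) = p e by rewrite /conjl mulgK.
  by rewrite -extJc /s /conjl [e ^+ 2]expgS expg1 !mulgA !mulgVK.
(* The kernel does not grow: an element of the new coset over 1 would put [x] in the image of
   [p]. *)
- case=> e []; rewrite /p' /= => pe; last first.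
    by have [u ->] := ext_ker ext pe; exists u.
  have : p e^-1 = x by rewrite extV -[RHS](mulKg (p e)) pe mulg1.
  by move/xE.
Qed.

End Theory.

Lemma squareExt_exists :
  exists (E : groupType) (p : E -> gT) (i : U -> E),
    squareExt p i /\ forall x, exists e, p e = x.
Proof.
suff tower n : exists (E : groupType) (p : E -> gT) (i : U -> E),
    squareExt p i /\ ((n <= #|[set x | `[< exists e, p e = x >]]%SET|)%N
                      \/ forall x, exists e, p e = x).
  (* The image cannot have more than |G| elements, so the tower has reached a surjection. *)
  have [E [p [i [ext [|surj]]]]] := tower #|gT|.+1.
    by rewrite ltnNge max_card.
  by exists E, p, i.
elim: n => [|n [E [p [i [ext [le_n|surj]]]]]].
- by exists U, bd, id; split; [apply: squareExt_base | left].
- have [surj|/existsNP[x nx]] := pselect (forall x, exists e, p e = x).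
    by exists E, p, i; split=> //; right.
  have xE e : p e <> x by move=> pe; apply: nx; exists e.
  have [E' [p' [i' [ext' x_im pp']]]] := squareExt_step ext xE.
  exists E', p', i'; split=> //; left; apply: leq_ltn_trans le_n _.
  apply/proper_card/properP; split.
    by apply/fintype.subsetP => y; rewrite !inE => -[e <-]; apply: pp'.
  by exists x; rewrite inE //; apply/asboolP.
- by exists E, p, i; split=> //; right.
Qed.

End SquareExtension.

(** * Homomorphisms to Z/2 separating points *)

Section Separation.
Variable H : groupType.

Definition subgroupClosed (X : H -> Prop) :=
  X 1 /\ forall x y, X x -> X y -> X (x * y^-1).

Lemma subgroupClosedV X x : subgroupClosed X -> X x -> X x^-1.
Proof. by case=> X1 Xdiv /(Xdiv _ _ X1); rewrite mul1g. Qed.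

Lemma subgroupClosedM X x y : subgroupClosed X -> X x -> X y -> X (x * y).
Proof.
move=> Xgrp Xx /(subgroupClosedV Xgrp) Xy.
by rewrite -[y]invgK; apply: Xgrp.2.
Qed.

Lemma maximal_subgroup (K N0 : H -> Prop) (m : H) :
    subgroupClosed N0 -> (forall x, N0 x -> K x) -> ~ N0 m ->
  exists N : H -> Prop,
    [/\ subgroupClosed N, forall x, N0 x -> N x, forall x, N x -> K x, ~ N m
      & forall X : H -> Prop, subgroupClosed X -> (forall x, X x -> K x) ->
          (forall x, N x -> X x) -> ~ X m -> forall x, X x -> N x].
Proof.
move=> N0grp N0K N0m.
(* Adjoining [N0] to every set lets the empty chain satisfy the hypothesis of [Zorn_bigcup]. *)
pose U (X : set H) := (X `|` N0)%classic.
pose P (X : set H) :=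
  [/\ subgroupClosed (U X), forall x, U X x -> K x & ~ U X m].
have [F FP Ftot|A [[Agrp AK Am] Amax]] := @Zorn_bigcup H P; last first.
  exists (U A); split=> // [x N0x|X Xgrp XK AX Xm x Xx]; first by right.
  have XE : U X = X.
    by apply/predeqP => y; split=> [[//|?]|]; [apply: AX; right | left].
  have [sAX|nAX] := pselect (A `<` X)%classic.
    by case: (Amax X sAX); rewrite /P XE.
  apply: contrapT => nUx; apply: nAX; rewrite properEneq; split.
    by apply/eqP => AX'; apply: nUx; left; rewrite AX'.
  by move=> y Ay; apply: AX; left.
have [->|/set0P[X0 FX0]] := eqVneq F set0.
  rewrite /P bigcup_set0 /U set0U; split=> //.
have UF x y :
    U (\bigcup_(X in F) X)%classic x -> U (\bigcup_(X in F) X)%classic y ->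
  exists X, [/\ F X, U X x & U X y].
  case=> [[X FX Xx]|N0x]; case=> [[Y FY Yy]|N0y].
  - have [XY|YX] := Ftot _ _ FX FY.
      by exists Y; split=> //; left=> //; apply: XY.
    by exists X; split=> //; left=> //; apply: YX.
  - by exists X; split=> //; [left | right].
  - by exists Y; split=> //; [right | left].
  - by exists X0; split=> //; right.
have sU X : F X -> (U X `<=` U (\bigcup_(X in F) X))%classic.
  by move=> FX x [Xx|N0x]; [left; exists X | right].
split.
- split; first by right; apply: N0grp.1.
  move=> x y Ux Uy; have [X [FX Xx Xy]] := UF x y Ux Uy.
  by apply: (sU X FX); have [Xgrp _ _] := FP X FX; apply: Xgrp.2.
- move=> x Ux; have [X [FX Xx _]] := UF x x Ux Ux.
  by have [_ + _] := FP X FX; apply.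
- move=> Um; have [X [FX Xm _]] := UF m m Um Um.
  by have [_ _] := FP X FX; apply.
Qed.

(** Take N maximal among the subgroups between [N0] and [K] that miss [m]. It contains all squares
    of [K], hence is normal in [K], and maximality gives it index 2; the indicator of its complement
    is the homomorphism. *)
Lemma square_separation (K N0 : H -> Prop) (m : H) :
    subgroupClosed K -> subgroupClosed N0 -> (forall x, N0 x -> K x) ->
    (forall x, K x -> N0 (x ^+ 2)) -> K m -> ~ N0 m ->
  exists f : H -> 'Z_2,
    (forall x y, K x -> K y -> f (x * y) = (f x + f y)%R) /\ f m = 1%R.
Proof.
move=> Kgrp N0grp N0K N0sq Km N0m.
have [N [Ngrp N0N NK Nm Nmax]] := maximal_subgroup N0grp N0K N0m.
have NM := subgroupClosedM Ngrp; have NV := subgroupClosedV Ngrp.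
have KM := subgroupClosedM Kgrp; have KV := subgroupClosedV Kgrp.
have NJ u n : K u -> N n -> N (u * n * u^-1).
  move=> Ku Nn; rewrite -[_ * _](mulgVK n).
  have -> : u * n * u^-1 * n^-1 = u ^+ 2 * (u^-1 * n) ^+ 2 * n^-1 ^+ 2.
    by rewrite !expgS !expg0 !mulg1 !mulgA mulgK mulgK.
  have Kn := NK n Nn.
  apply: (NM) => //; apply: N0N; apply: (subgroupClosedM N0grp).
    apply: (subgroupClosedM N0grp); apply: N0sq => //.
    by apply: KM => //; apply: KV.
  by apply/N0sq/KV.
have index2 u : K u -> ~ N u -> N (m * u^-1).
  move=> Ku Nu; apply: contrapT => nm.
  (* N together with Nu is a subgroup, because u^2 lies in N. If it missed [m], maximality would put
     [u] in N. *)
  pose X x := N x \/ N (x * u^-1).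
  have Nuu : N (u ^+ 2) by apply/N0N/N0sq.
  apply: Nu; apply: (Nmax X); last by right; rewrite mulgV; apply: Ngrp.1.
  - split; first by left; apply: Ngrp.1.
    move=> x y [Nx|Nx] [Ny|Ny].
    + by left; apply: Ngrp.2.
    + right; have -> : x * y^-1 * u^-1 = x * (u^-1 * (y * u^-1)^-1 * u^-1^-1) *
        (u ^+ 2)^-1.
        by rewrite expgS expg1 !invgM !invgK !mulgA mulgVK mulgK.
      apply: Ngrp.2 => //; apply: NM => //; apply: NJ; [exact: KV | exact: NV].
    + right; have -> : x * y^-1 * u^-1 = (x * u^-1) * (u * y^-1 * u^-1).
        by rewrite !mulgA mulgVK.
      by apply: NM => //; apply: NJ => //; apply: NV.
    + left; have -> : x * y^-1 = (x * u^-1) * (y * u^-1)^-1.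
        by rewrite invgM invgK !mulgA mulgVK.
      exact: Ngrp.2.
  - move=> x [/NK //|/NK Kx]; by rewrite -[x](mulgVK u); apply: KM.
  - by move=> x Nx; left.
  - by case.
exists (fun x => if `[< N x >] then 0%R else 1%R); split; last first.
  by case: asboolP.
move=> x y Kx Ky; case: (asboolP (N x)) => Nx; case: (asboolP (N y)) => Ny.
- by rewrite asboolT ?addr0 //; apply: NM.
- rewrite asboolF ?add0r // => Nxy; apply: Ny.
  by rewrite -[y](mulKg x); apply: NM => //; apply: NV.
- rewrite asboolF ?addr0 // => Nxy; apply: Nx.
  by rewrite -[x](mulgK y); apply: Ngrp.2.
- rewrite asboolT; first exact/val_inj.
  have Nmy : N (m * y^-1^-1).
    apply: index2; first exact: KV.
    by move/NV; rewrite invgK.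
  have -> : x * y = (m * x^-1)^-1 * (m * y^-1^-1).
    by rewrite invgM !invgK !mulgA mulgVK.
  by apply: NM => //; apply/NV/index2.
Qed.

End Separation.

(** * Twisted products and the pairing *)

Section TwistedProduct.
Variable gT : finGroupType.
Local Notation A := 'Z_2.

Lemma addZ2 (a : A) : (a + a = 0)%R.
Proof. by case: a => -[|[|//]] ?; apply: val_inj. Qed.

Lemma oppZ2 (a : A) : (- a = a)%R.
Proof. by apply/esym/eqP; rewrite -addr_eq0 addZ2. Qed.

Section Cocycle.
Variable c : cocycle2 gT A.

Lemma cocycle2E x y z :
  (c (x * y, z)%g = c (y, z) + c (x, y * z)%g + c (x, y))%R.
Proof.
have /eqP/ffunP/(_ (x, y, z)) := valP c; rewrite !ffunE => /eqP.
by rewrite subr_eq0 => /eqP e; rewrite -[c (x, y)]oppZ2 -e; ring.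
Qed.

Lemma cocycle2_1l x : c (1, x) = c (1, 1).
Proof. have := cocycle2E 1 1 x; rewrite !mul1g => /eqP.
by rewrite -addrA -subr_eq0 opprD addNKr oppr_eq0 addr_eq0 oppZ2 => /eqP.
Qed.

Lemma cocycle2_1r x : c (x, 1) = c (1, 1).
Proof. have := cocycle2E x 1 1; rewrite !mulg1 => /eqP.
by rewrite -addrA addZ2 addr0 => /eqP.
Qed.

Definition twisted of cocycle2 gT A : Type := (gT * A)%type.
Local Notation E := (twisted c).

HB.instance Definition _ := Choice.on E.

(* No signs appear in the inverse since A has characteristic 2, and the unit  *)
(* is (1, c (1, 1)) since cocycles are not normalized.                        *)
Definition twone : E := (1, c (1, 1)).
Definition twmul (e f : E) : E := (e.1 * f.1, (e.2 + f.2 + c (e.1, f.1))%R).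
Definition twinv (e : E) : E :=
  (e.1^-1, (e.2 + c (e.1^-1, e.1)%g + c (1, 1)%g)%R).

Fact twmulA : associative twmul.
Proof.
move=> [x a] [y b] [z d]; congr (_, _); rewrite /= ?mulgA //.
rewrite cocycle2E; have := addZ2 (c (x, y)); move: (c (x, y)) => k kk.
by rewrite -[LHS]addr0 -kk; ring: kk.
Qed.

Fact twmul1g : left_id twone twmul.
Proof.
case=> x a; congr (_, _); rewrite /= ?mul1g //.
by rewrite (cocycle2_1l x) addrAC addZ2 add0r.
Qed.

Fact twmulg1 : right_id twone twmul.
Proof.
case=> x a; congr (_, _); rewrite /= ?mulg1 //.
by rewrite (cocycle2_1r x) -addrA addZ2 addr0.
Qed.

Fact twmulVg : left_inverse twone twinv twmul.
Proof.
case=> x a; congr (_, _); rewrite /= ?mulVg //.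
have := addZ2 a; have := addZ2 (c (x^-1, x)).
move: (c (x^-1, x)) (c (1, 1)) => u v uu aa.
by ring: uu aa.
Qed.

Fact twmulgV : right_inverse twone twinv twmul.
Proof.
have inv2 e : twmul (twinv (twinv e)) (twinv e) = twone by rewrite twmulVg.
by move=> e; rewrite -[LHS]twmul1g -(inv2 e) -twmulA (twmulA (twinv e)) twmulVg
  twmul1g inv2.
Qed.

HB.instance Definition _ :=
  isGroup.Build E twmulA twmul1g twmulg1 twmulVg twmulgV.

Definition twlift (x : gT) : E := (x, 0%R).

Lemma tw_sqrE (e : E) : e ^+ 2 = (e.1 * e.1, c (e.1, e.1)).
Proof. by rewrite expgS expg1; congr (_, _); rewrite addZ2 add0r. Qed.

(** The fibre Z/2 is central of exponent 2 and cancels in squares, hence also in [comml] and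
    [ucomml], which are products of squares. *)
Lemma tw_sqr_congr (e e' : E) : e.1 = e'.1 -> e ^+ 2 = e' ^+ 2.
Proof. by rewrite !tw_sqrE => ->. Qed.

Lemma tw_ucomm_congr (e e' f f' : E) :
  e.1 = e'.1 -> f.1 = f'.1 -> ucomml e f = ucomml e' f'.
Proof.
move=> ee ff; rewrite !ucomml_sqr; congr (_ * _); apply: tw_sqr_congr => //=.
by rewrite ee ff.
Qed.

Lemma tw_comm_congr (e e' f f' : E) :
  e.1 = e'.1 -> f.1 = f'.1 -> comml e f = comml e' f'.
Proof.
move=> ee ff; rewrite !comml_sqr; congr (_ * _ * _); apply: tw_sqr_congr => //=.
  by rewrite ee ff.
by rewrite ff.
Qed.

Definition twsym (s : symbol gT) : E :=
  match s with
  | SComm x y => comml (twlift x) (twlift y)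
  | SUComm x y => ucomml (twlift x) (twlift y)
  | SSq z => twlift z ^+ 2
  end.

Lemma expgz_fst (e : E) i : (expgz e i).1 = expgz e.1 i.
Proof.
have expgn_fst n : (e ^+ n).1 = e.1 ^+ n.
  by elim: n => // n IHn; rewrite !expgS -IHn.
by case: i => n /=; rewrite -expgn_fst.
Qed.

(** As the choice of lifts is immaterial, a compound argument may be lifted to the same compound of
    lifts; each relation then becomes an identity of groups. *)
Lemma tw_relation u v : schur_relation u v -> flift twsym u = flift twsym v.
Proof.
have sqrE x (e : E) : e.1 = x -> twlift x ^+ 2 = e ^+ 2.
  by move=> <-; apply: tw_sqr_congr.
have ucommE x y (e f : E) :
    e.1 = x -> f.1 = y -> ucomml (twlift x) (twlift y) = ucomml e f.
  by move=> <- <-; apply: tw_ucomm_congr.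
have commE x y (e f : E) :
    e.1 = x -> f.1 = y -> comml (twlift x) (twlift y) = comml e f.
  by move=> <- <-; apply: tw_comm_congr.
case=> [x i j|x y|x y|x y z|x y z|x y z|x y z|x y z|a0 b0 b|a0 b0 a];
  rewrite ?(gmulfM, gmulfV) /= ?flift_gen /=.
- pose X := twlift x.
  rewrite (sqrE _ (expgz X i)) ?expgz_fst // (sqrE _ (expgz X j)) ?expgz_fst //.
  rewrite (sqrE _ (expgz X i * expgz X j)); last first.
    by rewrite expgzD -(expgz_fst X i) -(expgz_fst X j).
  rewrite expgMn //.
  have XX m n : commute (X ^+ m) (X ^+ n) by apply: commuteX2.
  by case: i j => m [] n /=;
    do ?[apply: commuteV | apply/commute_sym/commuteV/commute_sym].
- pose X := twlift x; pose Y := twlift y.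
  rewrite (ucommE _ _ X (X * Y)) // -/X -/Y.
  by rewrite /ucomml !expgS !expg0 !mulg1 !mulgA !mulgVK.
- pose X := twlift x; pose Y := twlift y.
  by rewrite (sqrE (x^-1 * y) (X^-1 * Y)) // (sqrE y^-1 Y^-1) // comml_sqr.
- pose X := twlift x; pose Y := twlift y; pose Z := twlift z.
  rewrite (commE (x * y) z (X * Y) Z) //.
  rewrite (ucommE (conjl x y) (conjl x z) (conjl X Y) (conjl X Z)) //.
  rewrite (ucommE x z^-1 X Z^-1) //.
  by rewrite /comml /ucomml /conjl ?(invgK, invgM) !mulgA !(mulgK, mulgVK).
- pose X := twlift x; pose Y := twlift y; pose Z := twlift z.
  rewrite (commE (conjl x y) (conjl x z) (conjl X Y) (conjl X Z)) //.
  rewrite (commE x (comml y z) X (comml Y Z)) //.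
  by rewrite /comml /conjl ?(invgK, invgM) !mulgA !(mulgK, mulgVK).
- pose X := twlift x; pose Y := twlift y; pose Z := twlift z.
  rewrite (ucommE (conjl x y) (conjl x z) (conjl X Y) (conjl X Z)) //.
  rewrite (commE x (ucomml y z) X (ucomml Y Z)) //.
  by rewrite /comml /ucomml /conjl ?(invgK, invgM) !mulgA !(mulgK, mulgVK).
- pose X := twlift x; pose Y := twlift y; pose Z := twlift z.
  rewrite (ucommE (conjl x y) (conjl x z) (conjl X Y) (conjl X Z)) //.
  rewrite (ucommE x (ucomml y z)^-1 X (ucomml Y Z)^-1) //.
  by rewrite /ucomml /conjl ?(invgK, invgM) !mulgA !(mulgK, mulgVK).
- pose X := twlift x; pose Y := twlift y; pose Z := twlift z.
  rewrite (commE (conjl z y) (conjl z x) (conjl Z Y) (conjl Z X)) //.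
  rewrite (sqrE (z * comml x y) (Z * comml X Y)) //.
  rewrite !expgS !expg0 !mulg1.
  by rewrite /comml /conjl ?(invgK, invgM) !mulgA !(mulgK, mulgVK).
- pose X := twlift a0; pose Y := twlift b0; pose Z := twlift b.
  rewrite (commE (conjl (b ^+ 2) a0) _
             (conjl (Z ^+ 2) X) (conjl (Z ^+ 2) Y)) //.
  by rewrite /comml /conjl ?(invgK, invgM) !mulgA !(mulgK, mulgVK).
- pose X := twlift a0; pose Y := twlift b0; pose Z := twlift a.
  rewrite (commE (conjl (a ^- 2) a0) _
             (conjl (Z ^- 2) X) (conjl (Z ^- 2) Y)) //.
  rewrite /comml /conjl ?(invgK, invgM) !mulgA !(mulgK, mulgVK).
  by rewrite mulgV mul1g.
Qed.

Lemma tw_relators w : schur_relators gT w -> flift twsym w = 1.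
Proof.
have K1 : flift twsym 1 = 1 by rewrite gmulf1.
have KM g h : flift twsym g = 1 -> flift twsym h = 1 -> flift twsym (g * h) = 1.
  by rewrite gmulfM /= => -> ->; rewrite mulg1.
have KV g : flift twsym g = 1 -> flift twsym g^-1 = 1.
  by rewrite gmulfV /= => ->; rewrite invg1.
have KJ g h : flift twsym g = 1 -> flift twsym (h * g * h^-1) = 1.
  by rewrite !gmulfM gmulfV /= => ->; rewrite mulg1 mulgV.
move/(_ (NormalSubgroup K1 KM KV KJ)); apply=> _ [u [v [uv ->]]].
by rewrite /= gmulfM gmulfV /= (tw_relation uv) mulgV.
Qed.

Lemma tw_fst w : (flift twsym w).1 = sgval (flift (@symbol_val gT) w).
Proof.
have symE s : (twsym s).1 = sgval (symbol_val s) by case: s.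
elim/freeGroup_ind: w => [|s w IHw|s w IHw]; first by rewrite !gmulf1.
  by rewrite !gmulfM /= !flift_gen /= IHw symE.
by rewrite !gmulfM !gmulfV /= !flift_gen /= IHw symE.
Qed.

(* On K' the value lies over 1; adding c (1, 1) measures it from the unit     *)
(* (1, c (1, 1)) of the twisted product.                                      *)
Definition pairing (w : freeGroup (symbol gT)) : A :=
  ((flift twsym w).2 + c (1, 1)%g)%R.

Local Notation kernel w := (flift (@symbol_val gT) w = 1).

Lemma kernel_fst w : kernel w -> (flift twsym w).1 = 1.
Proof. by rewrite tw_fst => ->. Qed.

Lemma pairingM v w : kernel v -> kernel w ->
  pairing (v * w) = (pairing v + pairing w)%R.
Proof.
move=> /kernel_fst v1 /kernel_fst w1; rewrite /pairing gmulfM /= v1 w1.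
by ring.
Qed.

Lemma pairing_relators w : schur_relators gT w -> pairing w = 0%R.
Proof. by move=> Nw; rewrite /pairing tw_relators //= addZ2. Qed.

(** A cochain [f] bounding [c] gives the homomorphism (x, a) -> a + f x to Z/2, which kills squares
    and hence all symbol values. *)
Lemma pairing_cobound (f : {ffun gT -> A}) w :
  cobound1 f = val c -> kernel w -> pairing w = 0%R.
Proof.
move=> df Kw.
have cE x y : c (x, y) = (f y + f (x * y)%g + f x)%R.
  by have /ffunP/(_ (x, y)) := df; rewrite !ffunE /= oppZ2 => /esym.
pose chi (e : E) : A := (e.2 + f e.1)%R.
have chiM e e' : chi (e * e') = (chi e + chi e')%R.
  rewrite /chi /= cE; have := addZ2 (f (e.1 * e'.1)%g).
  by move: (f _) (f _) (f _) => u v k kk; ring: kk.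
have chi1 : chi 1 = 0%R.
  by apply: (addrI (chi 1)); rewrite -chiM mulg1 addr0.
have chiV e : chi e^-1 = chi e.
  by apply: (addrI (chi e)); rewrite -chiM mulgV chi1 addZ2.
have chi_sqr e : chi (e ^+ 2) = 0%R by rewrite expgS expg1 chiM addZ2.
have chi_sym s : chi (twsym s) = 0%R.
  case: s => [x y|x y|z]; rewrite [twsym _]/=; last exact: chi_sqr.
    by rewrite comml_sqr chiM chi_sqr chiM !chi_sqr !addr0.
  by rewrite ucomml_sqr chiM !chi_sqr addr0.
have: chi (flift twsym w) = 0%R.
  elim/freeGroup_ind: w {Kw} => [|s w IHw|s w IHw]; first by rewrite gmulf1.
    by rewrite gmulfM /= flift_gen chiM chi_sym IHw addr0.
  by rewrite gmulfM gmulfV /= flift_gen chiM chiV chi_sym IHw addr0.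
rewrite /chi kernel_fst // /pairing => <-; congr (_ + _)%R.
by rewrite cE mulg1 addZ2 add0r.
Qed.

(** Here [m] is the nontrivial element of the central Z/2 and [N0] the image of the evaluation,
    which contains all squares. Vanishing of the pairing keeps [m] out of [N0], so some homomorphism
    to Z/2 is nonzero at [m]; restricted to the lifts (x, 0) it bounds [c]. *)
Lemma pairing_eq0_cobound :
    (forall w, kernel w -> pairing w = 0%R) ->
  exists f, cobound1 f = val c.
Proof.
move=> c0.
pose m : E := (1, (1 + c (1, 1)%g)%R).
pose N0 (e : E) := exists w, e = flift twsym w.
have N0_sqr e : N0 (e ^+ 2).
  exists (fgen (SSq e.1)); rewrite flift_gen.
  exact: tw_sqr_congr.
have [|||e|||f [fM fm]] := @square_separation E (fun _ => True) N0 m => //.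
- split; first by exists 1; rewrite gmulf1.
  move=> _ _ [v ->] [w ->]; exists (v * w^-1).
  by rewrite gmulfM gmulfV.
- case=> w mE; have Kw : kernel w.
    by apply: val_inj; have := tw_fst w; rewrite -mE.
  have := c0 w Kw; rewrite /pairing -mE /= -addrA addZ2 addr0.
  by move/eqP; rewrite oner_eq0.
have f_lift x (a : A) : f (x, a) = (f (twlift x) + a)%R.
  have [->|->] : a = 0%R \/ a = 1%R.
    by case: a => -[|[|//]] ?; [left | right]; apply: val_inj.
    by rewrite addr0.
  rewrite -fm -fM //; congr f; congr (_, _); rewrite /= ?mulg1 //.
  by rewrite (cocycle2_1r x) add0r -addrA addZ2 addr0.
exists [ffun x => f (twlift x)]; apply/ffunP=> -[x y]; rewrite !ffunE /=.
have := fM (twlift x) (twlift y) I I; rewrite /twlift {1}/mulg /= /twmul /=.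
rewrite f_lift !addr0 add0r => fE; rewrite oppZ2 addrAC [X in (X + _)%R]addrC.
by rewrite -fE addrAC addZ2 add0r.
Qed.

End Cocycle.

(** The Baer sum: adding second coordinates is a homomorphism from the fibre product over G of the
    two twisted products to that of [b + c], and [R] is its graph. *)
Lemma pairingD (b c : cocycle2 gT A) w :
  pairing (b + c)%R w = (pairing b w + pairing c w)%R.
Proof.
pose R (e : twisted (b + c)%R) (f : twisted b) (g : twisted c) :=
  [/\ e.1 = f.1, f.1 = g.1 & e.2 = (f.2 + g.2)%R].
have bcE x : (b + c)%R x = (b x + c x)%R by rewrite /= ffunE.
have R1 : R 1 1 1 by split=> //; apply: bcE.
have RM e f g e' f' g' : R e f g -> R e' f' g' -> R (e * e') (f * f') (g * g').
  move=> [/= ef fg e2] [/= ef' fg' e2']; split; rewrite /= ?ef ?ef' ?fg ?fg' //.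
  by rewrite e2 e2' bcE; ring.
have RV e f g : R e f g -> R e^-1 f^-1 g^-1.
  move=> [/= ef fg e2]; split; rewrite /= ?ef ?fg //.
  by rewrite e2 !bcE; ring.
have Rlift x : R (twlift _ x) (twlift _ x) (twlift _ x).
  by split; rewrite //= addr0.
have Rsym s : R (twsym _ s) (twsym _ s) (twsym _ s).
  have Rxy x y := RM _ _ _ _ _ _ (RM _ _ _ _ _ _ (Rlift x) (Rlift y))
                     (RV _ _ _ (Rlift x)).
  case: s => [x y|x y|z].
  - exact: (RM _ _ _ _ _ _ (Rxy x y) (RV _ _ _ (Rlift y))).
  - exact: (RM _ _ _ _ _ _ (Rxy x y) (Rlift y)).
  - exact: (RM _ _ _ _ _ _ (Rlift z) (Rlift z)).
have [_ _ e2] : R (flift (twsym _) w) (flift (twsym _) w) (flift (twsym _) w).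
  elim/freeGroup_ind: w => [|s w IHw|s w IHw]; first by rewrite !gmulf1.
    by rewrite !gmulfM /= !flift_gen; apply: RM.
  by rewrite !gmulfM !gmulfV /= !flift_gen; apply: RM => //; apply: RV.
by rewrite /pairing e2 bcE; ring.
Qed.
End TwistedProduct.

(** * Nondegeneracy on the side of K'/N' *)

Section Nondegeneracy.
Variable gT : finGroupType.
Local Notation A := 'Z_2.
Local Notation U := (symbolGroup gT).
Local Notation kernel w := (flift (@symbol_val gT) w = 1).

(** If [w] is not in N', some [phi] from the kernel M of [bd] to Z/2 is 1 on its class. Composing
    [phi] with the factor set of E for a section [s] gives a cocycle that pairs to 1 with [w]. *)
Lemma pairing_nondegenerate w : kernel w ->
  (forall c : cocycle2 gT A, pairing c w = 0%R) -> schur_relators gT w.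
Proof.
move=> Kw w0; apply: contrapT => Nw.
have [E [p [i [ext p_surj]]]] := squareExt_exists gT.
have [s ps] := choice p_surj.
pose u0 : U := qclass _ w.
pose M (u : U) := symbdry u = 1.
have MM u v : M u -> M v -> M (u * v).
  by rewrite /M symbdryM => -> ->; rewrite mulg1.
have M0 : M u0 by rewrite /M symbdry_class Kw.
have [||||||phi [phiM phi0]] :=
  @square_separation U M (fun u => u = 1) u0 => //.
- split; first exact: symbdry1.
  by move=> u v Mu Mv; apply: MM => //; rewrite /M symbdryV Mv invg1.
- by split=> // u v -> ->; rewrite invg1 mulg1.
- by move=> u ->; apply: symbdry1.
- by move=> u Mu; rewrite sym_sqr Mu symq1.
- by move=> u1; apply: Nw; have /qclassP := u1; rewrite invg1 mulg1.
have M1 : M 1 by apply: symbdry1.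
have phi1 : phi 1 = 0%R by apply: (addrI (phi 1)); rewrite -phiM // mulg1 addr0.
have iM := extiM ext; have pM := extM ext; have i_inj := exti_inj ext.
have dec e : exists u, e = i u * s (p e).
  have [|u eu] := ext_ker ext (e := e * (s (p e))^-1).
    by rewrite pM (extV ext) ps mulgV.
  by exists u; rewrite -eu mulgVK.
have [mu muE] := choice dec.
have Mmu e : M (mu e).
  have := congr1 p (muE e); rewrite pM ps (extpi ext) => /(canLR (mulgK _)).
  by rewrite mulgV => /esym.
have mu_uniq e u : e = i u * s (p e) -> mu e = u.
  by rewrite {1}(muE e) => /mulIg/i_inj.
have iC u e : M u -> e * i u = i u * e by apply: (ext_central ext).
pose cf : {ffun gT * gT -> A} := [ffun xy => phi (mu (s xy.1 * s xy.2))].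
have muM e f : mu (e * f) = mu e * mu f * mu (s (p e) * s (p f)).
  apply: mu_uniq; rewrite !iM -mulgA pM.
  have := muE (s (p e) * s (p f)); rewrite pM !ps => <-.
  rewrite {1}(muE e) {1}(muE f) !mulgA -(mulgA _ (s (p e)) (i (mu f))).
  by rewrite (iC (mu f) (s (p e))) // !mulgA.
have cf_cocycle : cf \in @cocycle2_pred gT A.
  rewrite inE; apply/eqP/ffunP=> -[[x y] z]; rewrite !ffunE /=.
  have : mu (s x * s y * s z) = mu (s x * (s y * s z)) by rewrite mulgA.
  have mus t : mu (s t) = 1.
    by apply: mu_uniq; rewrite (exti1 ext) mul1g ps.
  rewrite (muM (s x * s y)) (muM (s x) (s y * s z)) !mus mul1g mulg1 !pM !ps.
  by move=> /(congr1 phi); rewrite !phiM // => /(canRL (addrK _)) ->; ring.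
pose c := Cocycle2 cf_cocycle.
have cE x y : c (x, y) = phi (mu (s x * s y)) by rewrite /= ffunE.
(* The pushforward of E along [phi]. It carries squares to squares, so composed with [i] it is the
   evaluation of symbols. *)
pose Theta (e : E) : twisted c := (p e, phi (mu e)).
have ThetaM e f : Theta (e * f) = Theta e * Theta f.
  congr (_, _); first exact: pM.
  by rewrite muM !phiM ?cE //; apply: MM.
have Theta1 : Theta 1 = 1 by apply: (mulgI (Theta 1)); rewrite -ThetaM !mulg1.
have ThetaV e : Theta e^-1 = (Theta e)^-1.
  by apply: (mulgI (Theta e)); rewrite -ThetaM !mulgV.
have Theta_s x : Theta (s x) = twlift c x.
  congr (_, _); first exact: ps.
  by rewrite (mu_uniq _ 1) // (exti1 ext) mul1g ps.
have Theta_sqr e : Theta (e ^+ 2) = Theta e ^+ 2.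
  by rewrite !expgS !expg0 !mulg1 ThetaM.
have Theta_sym a : Theta (i (symclass a)) = twsym c a.
  case: a => [x y|x y|z] /=.
  - rewrite -/(symc x y) -{1}(ps x) -{1}(ps y) -(ext_comm ext) /comml.
    by rewrite !ThetaM !ThetaV !Theta_s.
  - rewrite -/(symd x y) symdE ucomml_sqr iM -{1 2}(ps x) -{1}(ps y).
    rewrite -(extV ext) -pM -!(ext_sqr ext) ThetaM !Theta_sqr.
    by rewrite ThetaM ThetaV !Theta_s.
  - by rewrite -/(symq z) -{1}(ps z) -(ext_sqr ext) Theta_sqr Theta_s.
have ThetaE v : flift (twsym c) v = Theta (i (qclass _ v)).
  elim/freeGroup_ind: v => [|a v IHv|a v IHv].
  - by rewrite gmulf1 qclass1 (exti1 ext) Theta1.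
  - by rewrite gmulfM /= flift_gen qclassM iM ThetaM Theta_sym IHv.
  - rewrite gmulfM gmulfV /= flift_gen qclassM qclassV iM (extiV ext).
    by rewrite ThetaM ThetaV Theta_sym IHv.
(* The section is not normalized: [s 1] is an element of M whose [phi] is c (1, 1), exactly the
   correction in [pairing]. *)
have s1 : s 1 = i (mu (s 1 * s 1)).
  apply: (mulIg (s 1)); have := muE (s 1 * s 1).
  by rewrite pM ps mulg1.
have u0E : mu (i u0) * mu (s 1 * s 1) = u0.
  by apply: i_inj; rewrite iM -s1 [RHS]muE (extpi ext) M0.
have := w0 c; rewrite /pairing ThetaE /Theta /= ffunE /= -phiM // u0E phi0.
by move/eqP; rewrite oner_eq0.
Qed.

End Nondegeneracy.

(** * Duality over F_2 *)

Section BinaryLinearAlgebra.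
Local Open Scope ring_scope.

Lemma F2_cases (a : 'F_2) : a = 0 \/ a = 1.
Proof. by case: a => -[|[|//]] ?; [left | right]; apply: val_inj. Qed.

Lemma additive0 (V W : zmodType) (f : V -> W) :
  {morph f : x y / x + y} -> f 0 = 0.
Proof. by move=> fD; apply: (addrI (f 0)); rewrite -fD !addr0. Qed.

Lemma additive_sum (V W : zmodType) (f : V -> W) (I : finType) (F : I -> V) :
  {morph f : x y / x + y} -> f (\sum_i F i) = \sum_i f (F i).
Proof. by move=> fD; apply: big_morph => //; apply: additive0. Qed.

Lemma F2_additive_row n (L : 'rV['F_2]_n -> 'F_2) z :
  {morph L : x y / x + y} -> L z = \sum_i z 0 i * L (delta_mx 0 i).
Proof.
move=> LD; rewrite {1}[z]row_sum_delta additive_sum //; apply: eq_bigr => i _.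
have [->|->] := F2_cases (z 0 i); last by rewrite scale1r mul1r.
by rewrite scale0r mul0r additive0.
Qed.

(** Over F_2 an additively closed set is a subspace; the matrix lists all its vectors as rows, with
    0 in place of the vectors outside. *)
Lemma F2_subspace n (P : 'rV['F_2]_n -> Prop) :
    P 0 -> (forall u v, P u -> P v -> P (u + v)) ->
  exists m (B : 'M['F_2]_(m, n)), forall v, (v <= B)%MS <-> P v.
Proof.
move=> P0 PD.
pose r (v : 'rV['F_2]_n) := if `[< P v >] then v else 0.
have Pr v : P (r v) by rewrite /r; case: asboolP.
exists #|{: 'rV['F_2]_n}|, (\matrix_i r (enum_val i)) => v; split; last first.
  move=> Pv; have := row_sub (enum_rank v) (\matrix_i r (enum_val i)).
  by rewrite rowK enum_rankK /r asboolT.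
case/submxP=> x ->; rewrite mulmx_sum_row; apply: (big_ind P) => // i _.
have [->|->] := F2_cases (x 0 i); first by rewrite scale0r.
by rewrite scale1r rowK.
Qed.

(** The F_2-space on [I] maps onto V; restricting to a complement of the kernel makes the map
    bijective. *)
Lemma F2_coordinates (V : zmodType) (I : finType) (h : I -> V) :
    (forall v : V, v + v = 0) -> (forall v, exists i, h i = v) ->
  exists n (g : 'rV['F_2]_n -> V),
    [/\ {morph g : x y / x + y}, injective g & forall v, exists x, g x = v].
Proof.
move=> V2 h_surj.
pose g0 (x : 'rV['F_2]_#|I|) := \sum_i h (enum_val i) *+ (x 0 i : nat).
have g0D : {morph g0 : x y / x + y}.
  move=> x y; rewrite -big_split; apply: eq_bigr => i _; rewrite mxE.
  rewrite /= -mulrnDr [in RHS](divn_eq (x 0 i + y 0 i) 2) mulrnDr mulnC mulrnA.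
  by rewrite mulr2n V2 mul0rn add0r.
have g0_surj v : exists x, g0 x = v.
  have [i <-] := h_surj v; exists (delta_mx 0 (enum_rank i)).
  rewrite /g0 (bigD1 (enum_rank i)) //= mxE !eqxx enum_rankK.
  rewrite big1 ?addr0 // => j.
  by rewrite mxE eqxx => /negPf->.
have [|x y x0 y0|m [K KE]] := @F2_subspace _ (fun x => g0 x = 0).
- exact: additive0.
- by rewrite g0D x0 y0 addr0.
pose B := row_base K^C%MS; pose g y := g0 (y *m B).
have gD : {morph g : x y / x + y} by move=> x y; rewrite /g mulmxDl g0D.
have g_eq0 y : g y = 0 -> y = 0.
  move/KE=> yK; apply: (row_free_inj (row_base_free K^C%MS)).
  rewrite mul0mx; apply/eqP; rewrite -submx0 -(capmx_compl K) sub_capmx yK.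
  by rewrite -(eq_row_base K^C%MS) submxMl.
exists _, g; split=> // [x y gxy|v].
  apply/eqP; rewrite -subr_eq0; apply/eqP/g_eq0.
  by apply: (addIr (g y)); rewrite -gD subrK gxy add0r.
have [x <-] := g0_surj v.
have /sub_addsmxP[[u1 u2] /= ->] : (x <= K + K^C)%MS.
  exact/submx_full/addsmx_compl_full.
have /submxP[y yE] : (u2 *m K^C <= B)%MS by rewrite eq_row_base submxMl.
by exists y; rewrite g0D yE (_ : g0 (u1 *m K) = 0) ?add0r //; apply/KE/submxMl.
Qed.

End BinaryLinearAlgebra.

(** * The pairing on cohomology classes *)

Section Cohomology.
Local Open Scope ring_scope.
Local Open Scope quotient_scope.
Variable gT : finGroupType.
Local Notation W := (cohomology2 gT 'Z_2).

Definition cohclass (c : cocycle2 gT 'Z_2) : W := \pi c.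

Lemma cohclassD b c : cohclass (b + c) = cohclass b + cohclass c.
Proof. exact: Quotient.pi_add. Qed.

Lemma cohclassP b c :
  cohclass b = cohclass c <-> exists f, cobound1 f = val (b - c).
Proof.
have := Quotient.idealrBE (coboundary2 (gT := gT) (A := 'Z_2)) b c.
rewrite inE => E; split=> [/eqP|df].
  by rewrite -[_ == _]E => /asboolP.
by apply/eqP; rewrite -[_ == _]E; apply/asboolP.
Qed.

Lemma cohclassK x : cohclass (generic_quotient.repr x) = x.
Proof. exact: reprK. Qed.

Lemma cocycle2_addrr (c : cocycle2 gT 'Z_2) : c + c = 0.
Proof. by apply/val_inj/ffunP=> x; rewrite !ffunE addZ2. Qed.

Definition cohpairing (x : W) (w : freeGroup (symbol gT)) : 'Z_2 :=
  pairing (generic_quotient.repr x) w.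

Local Notation kernel w := (flift (@symbol_val gT) w = 1%g).

Lemma cohpairingE c w : kernel w -> cohpairing (cohclass c) w = pairing c w.
Proof.
move=> Kw; have /cohclassP[f df] := cohclassK (cohclass c).
have := pairing_cobound df Kw; rewrite /cohpairing.
set b := generic_quotient.repr _.
have -> : - c = c by apply/esym/eqP; rewrite -addr_eq0 cocycle2_addrr.
by rewrite pairingD => /eqP; rewrite addr_eq0 oppZ2 => /eqP.
Qed.

Lemma cohpairingD w : kernel w -> {morph cohpairing^~ w : x y / x + y}.
Proof.
move=> Kw x y; rewrite -[x]cohclassK -[y]cohclassK -cohclassD !cohpairingE //.
exact: pairingD.
Qed.

Lemma cohomology2_addrr (x : W) : x + x = 0.
Proof.
rewrite -[x]cohclassK -cohclassD cocycle2_addrr.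
by apply: (addrI (cohclass 0)); rewrite -cohclassD !addr0.
Qed.

Lemma cohpairing_eq0 x : (forall w, kernel w -> cohpairing x w = 0) -> x = 0.
Proof.
move=> x0.
have [w Kw|f df] := @pairing_eq0_cobound gT (generic_quotient.repr x).
  exact: x0.
have c0 : cohclass 0 = 0.
  by apply: (addrI (cohclass 0)); rewrite -cohclassD !addr0.
by rewrite -[x]cohclassK -c0; apply/cohclassP; exists f; rewrite subr0.
Qed.

End Cohomology.

(** * The isomorphism *)

Theorem mainTheorem2 (gT : finGroupType) :
  exists f : unorientedSchurMultiplier gT -> cohomology2 gT 'Z_2,
    {morph f : u v / (u * v)%g >-> (u + v)%R} /\ bijective f.
Proof.
(* Non-cocycles are sent to the class of 0, so [h] is a surjection from a finite type. *)
pose h (c : {ffun gT * gT -> 'Z_2}) : cohomology2 gT 'Z_2 :=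
  cohclass (insubd 0%R c).
have [||n [g [gD g_inj g_surj]]] := F2_coordinates (h := h).
- exact: cohomology2_addrr.
- move=> x; exists (val (generic_quotient.repr x)).
  by rewrite /h valKd cohclassK.
have Kval (k : schur_kernel gT) : flift (@symbol_val gT) (val k) = 1.
  exact/eqP/(valP k).
(* The coordinates, in the dual basis, of the functional that [k] induces on H^2. *)
pose F (k : schur_kernel gT) : 'rV['F_2]_n :=
  (\row_i (cohpairing (g (delta_mx 0 i)) (val k) : 'F_2))%R.
have FE k z : (cohpairing (g z) (val k) = \sum_i z 0 i * F k 0 i :> 'F_2)%R.
  rewrite (F2_additive_row (L := fun z => cohpairing (g z) (val k)) z).
    by apply: eq_bigr => i _; rewrite mxE.
  by move=> x y; rewrite gD cohpairingD.
have FM k l : F (k * l) = (F k + F l)%R.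
  apply/rowP=> i; rewrite !mxE /cohpairing; exact: pairingM.
have FN k : F k = 0%R <-> schur_relators gT (val k).
  split=> [Fk|Nk]; last first.
    by apply/rowP=> i; rewrite !mxE; apply: pairing_relators.
  apply: pairing_nondegenerate => // c; rewrite -cohpairingE //.
  have [z <-] := g_surj (cohclass c); rewrite FE big1 // => i _.
  by rewrite Fk mxE mulr0.
apply: (@quotientGroup_bij _ _ _ (fun k => g (F k))) => [k l|k|x].
- by rewrite FM gD.
- split=> [gk|/FN ->]; last exact: additive0.
  by apply/FN/g_inj; rewrite (additive0 gD).
have [y <-] := g_surj x.
suff [k <-] : exists k, F k = y by exists k.
have [||m [J JE]] := @F2_subspace _ (fun y => exists k, F k = y).
- by exists 1; apply/FN; apply: nsub1.
- by move=> _ _ [k <-] [l <-]; exists (k * l).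
(* If the functionals did not span, a nonzero [z] would be orthogonal to all of them; but then the
   class [g z] pairs to 0 with all of K', so it vanishes. *)
apply/JE/submx_full; rewrite /row_full -mxrank_tr -/(row_free _) -kermx_eq0.
apply/eqP/row_matrixP => i; rewrite row0.
have zJ : (row i (kermx J^T) *m J^T = 0)%R by rewrite -row_mul mulmx_ker row0.
set z := row i _ in zJ *; apply: g_inj; rewrite (additive0 gD).
apply: cohpairing_eq0 => w Kw.
have Kw' : w \in kernel_pred (flift (@symbol_val gT)) by apply/eqP.
pose k : schur_kernel gT := KernelGroup Kw'.
rewrite (FE k z).
have /submxP[u ukJ] : (F k <= J)%MS by apply/JE; exists k.
have : (z *m (F k)^T = 0)%R by rewrite ukJ trmx_mul mulmxA zJ mul0mx.
move/rowP/(_ 0%R); rewrite [LHS]mxE [RHS]mxE => zF; rewrite -[RHS]zF.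
by apply: eq_bigr => j _; rewrite [(F k)^T%R _ _]mxE.
Qed.
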